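(* Let $k$ be a field, let $\kappa$ be a regular cardinal, and let $\alpha$ be an ordinal of cardinality smaller than $\kappa$. Then there is a set $\Lambda$ of cardinality smaller than $\kappa$ such that, for the $k$-algebra $R=k[(x_i)_{i\in\Lambda}]$ of polynomials in the set of variables indexed by $\Lambda$, there exists a $k$-linear quite $R$-differential operator $D_\alpha\colon R\to R$ of ordinal order $\alpha$.
   Context: Regular cardinals are infinite. Let $K\to R$ be a homomorphism of commutative rings, $U$, $V$ two $R$-modules, and $E=\mathrm{Hom}_K(U,V)$, which is an $R$-$R$-bimodule: $(re)(u)=r\,e(u)$, $(er)(u)=e(ru)$. Define by transfinite induction $F_0E=\{e\in E\mid re-er=0\text{ for all }r\in R\}$ and $F_\alpha E=\{e\in E\mid re-er\in\bigcup_{\beta<\alpha}F_\beta E\text{ for all }r\in R\}$ for every ordinal $\alpha>0$. A $K$-linear map $e\colon U\to V$ is a ($K$-linear) quite $R$-differential operator if $e\in F_\beta E$ for some ordinal $\beta$. It has ordinal order $\alpha$ if $\alpha$ is the smallest ordinal with $e\in F_\alpha E$ and $e\neq 0$ (the zero map has no ordinal order; by convention its order is $-1$). In the claim, $K=k$ and $U=V=R$. *)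

(* Defs.v *)
From HB Require Import structures.
From mathcomp Require Import all_boot all_algebra.
From mathcomp Require Import boolp classical_sets functions cardinality.
From mathcomp.multinomials Require Import monalg.

Set Implicit Arguments.
Unset Strict Implicit.
Unset Printing Implicit Defensive.

Import GRing.Theory.
Local Open Scope ring_scope.

(* Ordinals are represented by well-ordered types, so every notion below is   *)
(* meant up to order isomorphism.                                             *)
Record ord := Ord {
  ord_sort :> Type;
  olt : ord_sort -> ord_sort -> Prop;
  olt_wf : well_founded olt;
  olt_trans : forall x y z, olt x y -> olt y z -> olt x z;
  olt_total : forall x y, [\/ olt x y, x = y | olt y x]
}.

Definition initial_embedding (a b : ord) (f : a -> b) : Prop :=
  (forall x y, olt x y <-> olt (f x) (f y)) /\
  (forall x z, olt z (f x) -> exists y, f y = z).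

Definition ord_le (a b : ord) : Prop :=
  exists f : a -> b, initial_embedding f.

Definition ord_lt (a b : ord) : Prop :=
  exists2 f : a -> b, initial_embedding f &
    exists z : b, forall w, olt w z <-> exists x, f x = w.

(* A cardinal is represented by a type having that cardinality.               *)
Definition card_lt (A B : Type) : Prop :=
  ([set: A] #<= [set: B])%card /\ ~ ([set: B] #<= [set: A])%card.

Definition regular_cardinal (kappa : Type) : Prop :=
  infinite_set [set: kappa] /\
  (forall (I : Type) (A : I -> Type),
     card_lt I kappa -> (forall i, card_lt (A i) kappa) ->
     card_lt {i : I & A i} kappa).

Section QuiteDifferentialOperators.
Variables (K R : comPzRingType) (phi : {rmorphism K -> R}) (U V : lmodType R).

(* The elements of Hom_K(U, V), for the K-module structures of U and V        *)
(* obtained by restriction of scalars along phi.                              *)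
Definition HomK (e : U -> V) : Prop :=
  (forall u v, e (u + v) = e u + e v) /\
  (forall c u, e (phi c *: u) = phi c *: e u).

(* The element r e - e r of the R-R-bimodule Hom_K(U, V).                     *)
Definition bracket (r : R) (e : U -> V) : U -> V :=
  fun u => r *: e u - e (r *: u).

(* The filtration F_a of Hom_K(U, V); as ord_lt is well-founded, this         *)
(* inductive predicate is the transfinite recursion over the ordinal a        *)
(* (see ordF_zeroE and ordF_posE).                                            *)
Inductive ordF : ord -> (U -> V) -> Prop :=
| ordF_zero (a : ord) (e : U -> V) :
    ~ inhabited a -> HomK e ->
    (forall r u, bracket r e u = 0) -> ordF a e
| ordF_pos (a : ord) (e : U -> V) :
    inhabited a -> HomK e ->
    (forall r, exists2 b : ord, ord_lt b a & ordF b (bracket r e)) -> ordF a e.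

Lemma ordF_zeroE (a : ord) (e : U -> V) : ~ inhabited a ->
  ordF a e <-> HomK e /\ (forall r u, bracket r e u = 0).
Proof.
by move=> a0; split=> [h|[]]; [case: h a0 => // | constructor].
Qed.

Lemma ordF_posE (a : ord) (e : U -> V) : inhabited a ->
  ordF a e <->
  HomK e /\ (forall r, exists2 b : ord, ord_lt b a & ordF b (bracket r e)).
Proof.
by move=> a0; split=> [h|[]]; [case: h a0 => // | constructor 2].
Qed.

Definition quite_diff_op (e : U -> V) : Prop := exists b : ord, ordF b e.

Definition has_ordinal_order (e : U -> V) (a : ord) : Prop :=
  [/\ e <> (fun=> 0), ordF a e & forall b : ord, ordF b e -> ord_le a b].

End QuiteDifferentialOperators.

(* The k-algebra of polynomials in variables indexed by I.                    *)
Notation polyalg k I := {malg k[{cmonom I}]}.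

(* Main.v *)
(** The operators are D_0 = id and, for alpha > 0,
      D_alpha = sum_(beta < alpha) D_beta o d/dx_beta,
    where the variables x_beta are new and the D_beta act on pairwise disjoint
    blocks of further variables; each polynomial involves finitely many
    variables, so the sum is finite on it.  The bracket with x_beta is
    - D_beta, and for a variable x in the block of D_beta it is
    [x, D_beta] o d/dx_beta, of order at most beta, since composing with a
    derivation raises the order at most to its successor.  As brackets with
    products are controlled by brackets with factors, D_alpha lies in F_alpha;
    if it lies in F_gamma then gamma > beta for all beta < alpha, so that
    gamma >= alpha.  Unfolding the recursion, the variables of D_alpha are
    indexed by the finite nonempty descending chains in alpha. *)

Require Import Defs.
From mathcomp Require Import all_boot all_algebra.
From mathcomp Require Import boolp classical_sets cardinality.
From mathcomp Require Import finmap.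
From mathcomp.multinomials Require Import monalg.

Set Implicit Arguments.
Unset Strict Implicit.
Unset Printing Implicit Defensive.

Import GRing.Theory.
Local Open Scope ring_scope.

(** * Ordinals *)

Lemma olt_irr (a : ord) (x : a) : ~ olt x x.
Proof. by elim/(well_founded_ind (@olt_wf a)): x => x IH /[dup] /IH. Qed.

Lemma olt_ext (a : ord) (x y : a) : (forall w, olt w x <-> olt w y) -> x = y.
Proof.
move=> xy; have [/xy|//|/xy] := olt_total x y; by move/olt_irr.
Qed.

Lemma initial_embedding_lt (a b : ord) (f : a -> b) (x : a) (w : b) :
  initial_embedding f -> olt w (f x) <-> exists2 y, olt y x & f y = w.
Proof.
move=> [fh fi]; split=> [/[dup] wx /fi[y yw]|[y yx <-]]; last exact/fh.
by exists y => //; apply/fh; rewrite yw.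
Qed.

Lemma initial_embedding_unique (a b : ord) (f g : a -> b) :
  initial_embedding f -> initial_embedding g -> f =1 g.
Proof.
move=> fi gi; elim/(well_founded_ind (@olt_wf a)) => x IH.
apply: olt_ext => w; rewrite !initial_embedding_lt//.
by split=> -[y yx <-]; exists y; rewrite // IH.
Qed.

Lemma initial_embedding_inj (a b : ord) (f : a -> b) :
  initial_embedding f -> injective f.
Proof.
move=> [fh _] x y fxy.
by have [/fh|//|/fh] := olt_total x y; rewrite fxy => /olt_irr.
Qed.

Lemma initial_embedding_comp (a b c : ord) (f : a -> b) (g : b -> c) :
  initial_embedding f -> initial_embedding g -> initial_embedding (g \o f).
Proof.
move=> fi gi; split=> [x y|x w /=].
  by case: fi gi => fh _ [gh _]; rewrite fh gh.
case/(initial_embedding_lt _ _ gi) => y.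
by case/(initial_embedding_lt _ _ fi) => z _ <- <-; exists z.
Qed.

Lemma ord_le_lt_trans (a b c : ord) : ord_le a b -> ord_lt b c -> ord_lt a c.
Proof.
move=> [f fi] [g gi [z gz]]; exists (g \o f); first exact: initial_embedding_comp.
(* If the image of [f] is the segment below some [y], then [g y] bounds the composite. Otherwise [f]
   is onto, since a least missed point would be such a [y], and [z] is the bound. *)
have [[y yf]|fS] := pselect (exists y, forall w, olt w y <-> exists x, f x = w).
  exists (g y) => w; rewrite initial_embedding_lt//; split.
    by move=> [v /yf[x <-] <-]; exists x.
  by move=> [x <-]; exists (f x) => //; apply/yf; exists x.
suff surj y : exists x, f x = y.
  exists z => w; rewrite gz; split=> -[x <-]; last by exists (f x).
  by have [v <-] := surj x; exists v.
elim/(well_founded_ind (@olt_wf b)): y => y IH.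
apply: contrapT => yf; apply: fS; exists y => w; split=> [/IH//|[x fx]].
have [//|wy|yw] := olt_total w y; first by case: yf; exists x; rewrite fx.
by case: yf; case: fi => _ /(_ x y); rewrite fx => /(_ yw).
Qed.

Lemma ord_lt_le_trans (a b c : ord) : ord_lt a b -> ord_le b c -> ord_lt a c.
Proof.
move=> [f fi [z fz]] [g gi]; exists (g \o f); first exact: initial_embedding_comp.
exists (g z) => w; rewrite initial_embedding_lt//; split.
  by move=> [v /fz[x <-] <-]; exists x.
by move=> [x <-]; exists (f x) => //; apply/fz; exists x.
Qed.

Lemma ord_le_empty (a b : ord) : ~ inhabited a -> ord_le a b.
Proof.
move=> a0; have F (x : a) : False by apply: a0; constructor.
by exists (fun x => False_rect _ (F x)); split=> x; case: (F x).
Qed.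

Lemma ord_lt_wf : well_founded ord_lt.
Proof.
(* An ordinal below [b] embeds in [a] below some [f y], itself below [z]; accessibility thus follows
   by induction on [z] inside the fixed order [a]. *)
suff key (a : ord) (z : a) (b : ord) (f : b -> a) : initial_embedding f ->
    (forall x, olt (f x) z) -> Acc ord_lt b.
  move=> a; constructor => b [f fi [z fz]].
  by apply: (key _ z _ f fi) => x; apply/fz; exists x.
elim/(well_founded_ind (@olt_wf a)): z b f => z IH b f fi fz.
constructor => c [g gi [y gy]].
apply: (IH (f y) (fz y) c (f \o g)) => [|x]; first exact: initial_embedding_comp.
by case: (fi) => fh _; apply/fh/gy; exists x.
Qed.

(** Both ordinals are initial segments of [a], so comparing their bounds inside [a] suffices. *)
Lemma ord_lt_linear (a b c : ord) : ord_lt b a -> ord_lt c a ->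
  ord_le b c \/ ord_le c b.
Proof.
suff key (b' c' : ord) (f : b' -> a) (g : c' -> a) (y z : a) :
    initial_embedding f -> initial_embedding g ->
    (forall w, olt w y <-> exists x, f x = w) ->
    (forall w, olt w z <-> exists x, g x = w) ->
    y = z \/ olt y z -> ord_le b' c'.
  move=> [f fi [y fy]] [g gi [z gz]].
  have [yz|yz|zy] := olt_total y z.
  - by left; apply: key fi gi fy gz _; right.
  - by left; apply: key fi gi fy gz _; left.
  - by right; apply: key gi fi gz fy _; right.
move=> fi gi fy gz yz.
have /choice[h hE] x : exists v, g v = f x.
  apply/gz; have fxy : olt (f x) y by apply/fy; exists x.
  by case: yz => [<-//|]; apply: olt_trans.
exists h; split=> [x x'|x v]; case: (fi) (gi) => fh fs [gh gs].
  by rewrite gh !hE -fh.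
rewrite gh hE => /fs[x' fx']; exists x'.
by apply: (initial_embedding_inj gi); rewrite hE.
Qed.

(** * Proper initial segments as ordinals *)

Section Segment.
Variables (a : ord) (y : a).

Definition seg_olt (u v : {x | olt x y}) := olt (sval u) (sval v).

Lemma seg_olt_wf : well_founded seg_olt.
Proof.
by move=> [x]; elim/(well_founded_ind (@olt_wf a)): x => x IH xy;
  constructor=> -[z zy] zx; apply: IH.
Qed.

Lemma seg_olt_trans u v w : seg_olt u v -> seg_olt v w -> seg_olt u w.
Proof. exact: olt_trans. Qed.

Lemma seg_olt_total u v : [\/ seg_olt u v, u = v | seg_olt v u].
Proof.
case: u v => [x xy] [z zy].
have [xz|xz|zx] := olt_total x z; [exact: Or31 | | exact: Or33].
exact/Or32/eq_exist.
Qed.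

Definition seg : ord := Ord seg_olt_wf seg_olt_trans seg_olt_total.

Lemma seg_embedding : initial_embedding (fun u : seg => sval u).
Proof.
split=> // -[x xy] z /= zx.
by exists (exist _ z (olt_trans zx xy)).
Qed.

Lemma seg_lt : ord_lt seg a.
Proof.
exists (fun u : seg => sval u); first exact: seg_embedding.
exists y => w; split=> [wy|[[x xy] <-]//].
by exists (exist _ w wy).
Qed.

End Segment.

Lemma ord_lt_empty (a : ord) : inhabited a ->
  exists2 b : ord, ord_lt b a & ~ inhabited b.
Proof.
move=> [x]; elim/(well_founded_ind (@olt_wf a)): x => x IH.
have [[[y /IH//]]|x0] := pselect (inhabited (seg x)).
by exists (seg x); first exact: seg_lt.
Qed.

(** The embedding sends [y] to the bound in [b] of the image of the segment below [y]. *)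
Lemma ord_le_seg (a b : ord) : (forall y : a, ord_lt (seg y) b) -> ord_le a b.
Proof.
move=> ab.
have bound_ex (y : a) : exists z : b, exists2 f : seg y -> b,
    initial_embedding f & forall w, olt w z <-> exists x, f x = w.
  by have [f fi [z fz]] := ab y; exists z, f.
have [g gP] := choice bound_ex.
have gE y x : olt x (g y) <-> exists2 y', olt y' y & g y' = x.
  have [f fi fE] := gP y; rewrite fE.
  (* Restricted to the segment below [sval u], the embedding [f] is, by uniqueness, the one chosen
     for [sval u]; hence [f u] and [g (sval u)] have the same predecessors. *)
  suff fg u : f u = g (sval u).
    split=> [[[y' yy] <-]|[y' yy <-]]; first by exists y'; rewrite // fg.
    by exists (exist _ y' yy); rewrite fg.
  apply: olt_ext => w; rewrite (initial_embedding_lt _ _ fi).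
  have [h hi ->] := gP (sval u).
  pose i (v : seg (sval u)) : seg y :=
    exist _ (sval v) (olt_trans (svalP v) (svalP u)).
  have fii : initial_embedding (f \o i).
    apply: initial_embedding_comp fi; split=> // v z zv.
    exists (exist _ (sval z) (olt_trans zv (svalP v))).
    by case: z zv => z zy zv; apply: eq_exist.
  have fh := initial_embedding_unique fii hi.
  split=> [[v vu <-]|[v <-]]; last by exists (i v); [exact: svalP v | exact: fh].
  exists (exist _ (sval v) vu); rewrite -fh /=; congr f.
  by case: v vu => v vy vu; apply: eq_exist.
have gh x y : olt x y -> olt (g x) (g y) by move=> xy; apply/gE; exists x.
exists g; split=> [x y|x w /gE[y _ <-]]; last by exists y.
split; first exact: gh.
have [//|->/olt_irr//|/gh yx xy] := olt_total x y.
by case: (olt_irr (olt_trans xy yx)).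
Qed.

(** * The filtration *)

Section Filtration.
Variables (K R : comPzRingType) (phi : {rmorphism K -> R}) (U V : lmodType R).
Implicit Types (a b c : ord) (e : U -> V) (r s : R).

Local Notation HomK := (HomK phi).
Local Notation ordF := (ordF phi).

Lemma HomK0 : HomK (fun _ : U => 0 : V).
Proof. by split=> *; rewrite ?addr0 ?scaler0. Qed.

Lemma HomKD e1 e2 : HomK e1 -> HomK e2 -> HomK (fun u => e1 u + e2 u).
Proof.
move=> [a1 l1] [a2 l2]; split=> [u v|c u]; first by rewrite a1 a2 addrACA.
by rewrite l1 l2 scalerDr.
Qed.

Lemma HomKZ r e : HomK e -> HomK (fun u => r *: e u).
Proof.
move=> [ae le]; split=> [u v|c u]; first by rewrite ae scalerDr.
by rewrite le !scalerA mulrC.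
Qed.

Lemma HomKZr r e : HomK e -> HomK (fun u => e (r *: u)).
Proof.
move=> [ae le]; split=> [u v|c u]; first by rewrite scalerDr ae.
by rewrite -le !scalerA mulrC.
Qed.

Lemma HomK_comp (W : lmodType R) (T : W -> U) e :
  Defs.HomK phi T -> HomK e -> Defs.HomK phi (e \o T).
Proof.
by move=> [aT lT] [ae le]; split=> [u v|c u] /=; rewrite ?aT ?ae ?lT ?le.
Qed.

Lemma HomK_eq0 e : HomK e -> e 0 = 0.
Proof. by move=> [ae _]; apply: (addrI (e 0)); rewrite -ae !addr0. Qed.

Lemma HomKN e u : HomK e -> e (- u) = - e u.
Proof.
by move=> he; apply: (addrI (e u)); case: (he) => <- _; rewrite !subrr HomK_eq0.
Qed.

Lemma ordF_HomK a e : ordF a e -> HomK e.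
Proof. by case. Qed.

(** For positive [a], all brackets are the zero map, which lies in F_0, a level below [a]. *)
Lemma ordF_central a e : HomK e -> (forall r u, bracket r e u = 0) -> ordF a e.
Proof.
move=> eK e0; have [a1|a0] := pselect (inhabited a); last exact: ordF_zero.
have [c ca c0] := ord_lt_empty a1.
apply: ordF_pos => // r; exists c => //.
have -> : bracket r e = fun=> 0 by apply/funext => u; rewrite e0.
apply: ordF_zero => //; first exact: HomK0.
by move=> r' u; rewrite /bracket scaler0 subrr.
Qed.

Lemma ordF0 a : ordF a (fun _ : U => 0 : V).
Proof.
apply: ordF_central; first exact: HomK0.
by move=> r u; rewrite /bracket scaler0 subrr.
Qed.

Lemma ordF_le a b e : ord_le a b -> ordF a e -> ordF b e.
Proof.
move=> ab F; case: F ab => {}a {}e.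
  by move=> _ eK e0 _; apply: ordF_central.
move=> [x] eK eF ab; apply: ordF_pos => // [|r].
  by case: ab => f _; constructor; exact: f.
have [c ca cF] := eF r; exists c => //.
exact: ord_lt_le_trans ab.
Qed.

Lemma ordFD a e1 e2 : ordF a e1 -> ordF a e2 -> ordF a (fun u => e1 u + e2 u).
Proof.
elim/(well_founded_ind ord_lt_wf): a e1 e2 => a IH e1 e2 F1 F2.
have e12K := HomKD (ordF_HomK F1) (ordF_HomK F2).
have bE r : bracket r (fun u => e1 u + e2 u) =
    fun u => bracket r e1 u + bracket r e2 u.
  by apply/funext => u; rewrite /bracket scalerDr opprD addrACA.
have [a1|a0] := pselect (inhabited a); last first.
  move/(ordF_zeroE _ _ a0): F1 => [_ F1]; move/(ordF_zeroE _ _ a0): F2 => [_ F2].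
  by apply: ordF_central => // r u; rewrite bE F1 F2 addr0.
apply: ordF_pos => // r; rewrite bE.
move/(ordF_posE _ _ a1): F1 => [_ /(_ r)[b ba F1]].
move/(ordF_posE _ _ a1): F2 => [_ /(_ r)[c ca F2]].
(* The two brackets may lie at different levels below [a]; the larger level contains both. *)
have [bc|cb] := ord_lt_linear ba ca.
  by exists c => //; apply: IH => //; apply: ordF_le F1.
by exists b => //; apply: IH => //; apply: ordF_le F2.
Qed.

Lemma ordFZ a s e : ordF a e -> ordF a (fun u => s *: e u).
Proof.
elim/(well_founded_ind ord_lt_wf): a e => a IH e F.
have seK := HomKZ s (ordF_HomK F).
have bE r : bracket r (fun u => s *: e u) = fun u => s *: bracket r e u.
  by apply/funext => u; rewrite /bracket scalerBr !scalerA mulrC.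
have [a1|a0] := pselect (inhabited a); last first.
  move/(ordF_zeroE _ _ a0): F => [_ F].
  by apply: ordF_central => // r u; rewrite bE F scaler0.
apply: ordF_pos => // r; rewrite bE.
move/(ordF_posE _ _ a1): F => [_ /(_ r)[b ba F]].
by exists b => //; apply: IH.
Qed.

Lemma ordFZr a s e : ordF a e -> ordF a (fun u => e (s *: u)).
Proof.
elim/(well_founded_ind ord_lt_wf): a e => a IH e F.
have seK := HomKZr s (ordF_HomK F).
have bE r : bracket r (fun u => e (s *: u)) = fun u => bracket r e (s *: u).
  by apply/funext => u; rewrite /bracket !scalerA mulrC.
have [a1|a0] := pselect (inhabited a); last first.
  move/(ordF_zeroE _ _ a0): F => [_ F].
  by apply: ordF_central => // r u; rewrite bE F.
apply: ordF_pos => // r; rewrite bE.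
move/(ordF_posE _ _ a1): F => [_ /(_ r)[b ba F]].
by exists b => //; apply: IH.
Qed.

Lemma ordFN a e : ordF a e -> ordF a (fun u => - e u).
Proof.
move/(ordFZ (-1)); congr ordF; apply/funext => u.
by rewrite scaleN1r.
Qed.

(** This rule reduces brackets with polynomials to brackets with variables. *)
Lemma bracketM r s e u :
  bracket (r * s) e u = r *: bracket s e u + bracket r e (s *: u).
Proof. by rewrite /bracket scalerBr !scalerA subrKA. Qed.

Lemma bracketD r s e u : HomK e ->
  bracket (r + s) e u = bracket r e u + bracket s e u.
Proof.
by move=> [ae _]; rewrite /bracket !scalerDl ae opprD addrACA.
Qed.

Lemma bracket_phi (c : K) e u : HomK e -> bracket (phi c) e u = 0.
Proof. by move=> [_ le]; rewrite /bracket le subrr. Qed.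

(* Since [r, e T] = [r, e] T + e [r, T], composing with an operator of order  *)
(* at most one raises the order at most to its successor.                     *)
Lemma ordF_comp (T : U -> U) a b e :
  Defs.HomK phi T -> (forall r, exists s, forall u, bracket r T u = s *: u) ->
  ordF b e -> ord_lt b a -> ordF a (e \o T).
Proof.
move=> TK Ts; elim/(well_founded_ind ord_lt_wf): b a e => b IH a e F ba.
have eK := ordF_HomK F.
apply: ordF_pos; first by case: ba => f _ [z _]; constructor.
  exact: HomK_comp.
move=> r; exists b => //; have [s Ts'] := Ts r.
rewrite (_ : bracket r (e \o T) =
    fun u => (bracket r e \o T) u + e (s *: u)); last first.
  apply/funext => u; rewrite /= -Ts' /bracket /=.
  rewrite (_ : e (_ - _) = e (r *: T u) - e (T (r *: u))).
    by rewrite addrA subrK.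
  by case: (eK) => -> _; rewrite HomKN.
apply: ordFD; last exact: ordFZr.
have [b1|b0] := pselect (inhabited b).
  move/(ordF_posE _ _ b1): F => [_ /(_ r)[c cb F]].
  by apply: (IH c).
move/(ordF_zeroE _ _ b0): F => [_ F].
rewrite (_ : _ \o _ = fun=> 0); first exact: ordF0.
by apply/funext => u /=; rewrite F.
Qed.

End Filtration.

(** * Partial derivatives of polynomials *)

Section PartialDerivatives.
Variables (k : comNzRingType) (I : choiceType).

(** What the construction uses of a polynomial algebra: generation by constants and variables, and
    linear derivatives with the Leibniz rule for multiplication by a variable. *)
Record partials (R : comAlgType k) := Partials {
  var : I -> R;
  pderiv : I -> R -> R;
  partials_ind : forall P : R -> Prop,
    (forall c : k, P c%:A) -> (forall f g, P f -> P g -> P (f + g)) ->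
    (forall i f, P f -> P (var i * f)) -> forall f, P f;
  pderivD : forall i f g, pderiv i (f + g) = pderiv i f + pderiv i g;
  pderivZ : forall i (c : k) f, pderiv i (c *: f) = c *: pderiv i f;
  pderiv1 : forall i, pderiv i 1 = 0;
  pderivX : forall i j f,
    pderiv i (var j * f) = f *+ (i == j) + var j * pderiv i f
}.

Lemma divcmK (m : {cmonom I}) i :
  m i != 0%N -> mulcm (ucm i) (divcm m (ucm i)) = m.
Proof.
move=> mi; apply/eqP/cmP => j; rewrite mulcmE divcmE ucmE.
by case: eqVneq => [<-|_]; rewrite ?subn0 // subnKC // lt0n.
Qed.

(* The algebra is kept abstract because the unifier unfolds the operations of *)
(* {malg k[_]} and diverges on failing matches.                               *)
Section MonomialBasis.
Variables (R : comAlgType k) (mon : k -> {cmonom I} -> R) (pd : I -> R -> R).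
Hypotheses (mon_ind : forall P : R -> Prop,
    (forall f g, P f -> P g -> P (f + g)) -> (forall c m, P (mon c m)) ->
    forall f, P f)
  (monD : forall c d m, mon (c + d) m = mon c m + mon d m)
  (monM : forall c d m m', mon c m * mon d m' = mon (c * d) (mulcm m m'))
  (mon1 : forall c, mon c (onecm I) = c%:A)
  (pdD : forall i f g, pd i (f + g) = pd i f + pd i g)
  (pdU : forall i c m, pd i (mon c m) = mon (c * (m i)%:R) (divcm m (ucm i))).

Let mon0 m : mon 0 m = 0.
Proof. by apply: (addrI (mon 0 m)); rewrite -monD !addr0. Qed.

Lemma monomial_partials_ind (P : R -> Prop) :
  (forall c : k, P c%:A) -> (forall f g, P f -> P g -> P (f + g)) ->
  (forall i f, P f -> P (mon 1 (ucm i) * f)) -> forall f, P f.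
Proof.
move=> PC PD PX; elim/mon_ind => [//|c m].
(* Induction on the degree: a monomial other than 1 is a variable times a monomial of smaller
   degree. *)
have [n] := ubnP (mdeg m); elim: n m => // n IH m mn.
have [->|m1] := eqVneq m (onecm I); first by rewrite mon1.
have [i mi] : exists i, m i != 0%N.
  apply: contrapT => m0; move/eqP: m1; apply; apply/eqP/cmP => i.
  rewrite onecmE; apply/eqP; apply: contrapT => /negP mi.
  by apply: m0; exists i.
rewrite -(divcmK mi) -[c]mul1r -monM; apply: PX; apply: IH.
by move: mn; rewrite -{1}(divcmK mi) (mdegM (ucm i)) (mdegU i) add1n ltnS.
Qed.

Lemma monomial_pderivZ i (c : k) f : pd i (c *: f) = c *: pd i f.
Proof.
elim/mon_ind: f => [f g IHf IHg|d m].
  by rewrite scalerDr !pdD scalerDr IHf IHg.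
have monZ e m' : c *: mon e m' = mon (c * e) m'.
  by rewrite -mulr_algl -mon1 monM mul0cm.
by rewrite monZ !pdU monZ mulrA.
Qed.

Lemma monomial_pderiv1 i : pd i 1 = 0.
Proof. by rewrite -(scale1r 1) -mon1 pdU onecmE mulr0 mon0. Qed.

Lemma monomial_pderivX i j f :
  pd i (mon 1 (ucm j) * f) = f *+ (i == j) + mon 1 (ucm j) * pd i f.
Proof.
elim/mon_ind: f => [f g IHf IHg|c m].
  by rewrite mulrDr !pdD IHf IHg mulrDr mulrnDl addrACA.
rewrite monM !pdU monM !mul1r mulcmE ucmE eq_sym.
have [->|ij] := eqVneq i j.
  have -> : divcm (mulcm (ucm j) m) (ucm j) = m.
    by apply/eqP/cmP => l; rewrite divcmE mulcmE addKn.
  rewrite natrD mulrDr mulr1 monD; congr (_ + _).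
  (* At exponent zero [divcm] truncates, but the coefficient [m j] vanishes too. *)
  have [->|mj] := eqVneq (m j) 0%N; first by rewrite mulr0 !mon0.
  by rewrite divcmK.
rewrite mulr0n add0r add0n.
have [->|mi] := eqVneq (m i) 0%N; first by rewrite mulr0 !mon0.
congr mon; apply/eqP/cmP => l; rewrite divcmE !mulcmE divcmE !ucmE addnBA //.
by case: eqVneq => [<-|]; rewrite ?lt0n.
Qed.

Definition monomial_partials : partials R :=
  Partials monomial_partials_ind pdD monomial_pderivZ monomial_pderiv1
    monomial_pderivX.

End MonomialBasis.

(** * The polynomial algebra as an instance *)

Definition polyalg_mon (c : k) (m : {cmonom I}) : polyalg k I := << c *g m >>.

Definition polyalg_pd (i : I) : polyalg k I -> polyalg k I :=
  mmap (@malgC {cmonom I} k) (fun m => << (m i)%:R *g divcm m (ucm i) >>).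

Lemma polyalg_mon_ind (P : polyalg k I -> Prop) :
  (forall f g, P f -> P g -> P (f + g)) -> (forall c m, P (polyalg_mon c m)) ->
  forall f, P f.
Proof.
move=> PD PU f; rewrite (monalgE f).
apply: (big_ind P) => [|//|m _]; last exact: PU.
by rewrite -(monalgU0 (onecm I : {cmonom I})); apply: PU.
Qed.

Lemma polyalg_monD c d m :
  polyalg_mon (c + d) m = polyalg_mon c m + polyalg_mon d m.
Proof. exact: monalgUD. Qed.

Lemma polyalg_monM c d m m' :
  polyalg_mon c m * polyalg_mon d m' = polyalg_mon (c * d) (mulcm m m').
Proof. by rewrite /polyalg_mon malgM_def fgmulUU. Qed.

Lemma polyalg_mon1 c : polyalg_mon c (onecm I) = c%:A.
Proof. by rewrite -mul_malgC mulr1. Qed.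

Lemma polyalg_pdD i f g : polyalg_pd i (f + g) = polyalg_pd i f + polyalg_pd i g.
Proof. exact: mmapD. Qed.

Lemma polyalg_pdU i c m :
  polyalg_pd i (polyalg_mon c m) =
  polyalg_mon (c * (m i)%:R) (divcm m (ucm i)).
Proof.
rewrite /polyalg_pd /polyalg_mon mmapU malgM_def fgmulUU.
by rewrite [mmul _ _]mul0cm.
Qed.

Definition polyalg_partials : partials (polyalg k I) :=
  monomial_partials polyalg_mon_ind polyalg_monD polyalg_monM polyalg_mon1
    polyalg_pdD polyalg_pdU.

End PartialDerivatives.

Arguments partials_ind {k I R} p P _ _ _ f.

(** * Operators of prescribed order *)

(** [Last y] indexes the new variable x_y of the outermost sum; [More y s] indexes the variable [s]
    in the block of D_y. *)
Inductive chain (a : ord) : Type :=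
| Last of a
| More (y : a) of chain (seg y).

Definition chain_uncons (a : ord) (s : chain a) :
    {y : a & option (chain (seg y))} :=
  match s with Last y => existT _ y None | More y s => existT _ y (Some s) end.

Lemma chain_uncons_inj (a : ord) : injective (@chain_uncons a).
Proof.
pose g (x : {y : a & option (chain (seg y))}) : chain a :=
  match x with existT y (Some s) => More s | existT y None => Last y end.
by apply: (@can_inj _ _ _ g); case.
Qed.

Lemma More_inj (a : ord) (y : a) : injective (@More a y).
Proof.
move=> s t /(congr1 (@chain_uncons a)) /= e.
(* The second components agree along a proof of [y = y], which proof irrelevance turns into
   [erefl]. *)
have := projT2_eq e; rewrite (Prop_irrelevance (projT1_eq e) erefl).
by case.
Qed.

Section Operators.
Variables (k : comNzRingType) (I : choiceType) (R : comAlgType k).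
Variable p : partials I R.
Implicit Types (i l : I) (E : I -> R^o -> R^o) (A : {fset I}).

Local Notation X := (var p).
Local Notation "∂" := (pderiv p).
Local Notation phi := (GRing.in_alg R).

Lemma pderiv_HomK i : HomK phi (∂ i : R^o -> R^o).
Proof.
split=> [u v|c u]; first exact: (pderivD p i u v).
by rewrite /= ![c%:A *: _]mulr_algl pderivZ.
Qed.

Lemma pderiv_alg i (c : k) : ∂ i c%:A = 0.
Proof. by rewrite pderivZ pderiv1 scaler0. Qed.

Lemma bracket_var_pderiv i l (u : R^o) :
  bracket (X l) (∂ i : R^o -> R^o) u = - (u *+ (i == l)).
Proof.
rewrite /bracket; have /= -> := pderivX p i l u.
by rewrite opprD addrCA subrr addr0.
Qed.

(** The multiplier [s] is minus the [i]-th derivative of [r]. This makes [ordF_comp] applicable to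
    partial derivatives. *)
Lemma bracket_pderiv i r :
  exists s : R, forall u, bracket r (∂ i : R^o -> R^o) u = s *: u.
Proof.
elim/(partials_ind p): r => [c|r r' [s rs] [s' rs']|l r [s rs]].
- exists 0 => u; rewrite scale0r (bracket_phi (phi := phi))//.
  exact: pderiv_HomK.
- exists (s + s') => u; rewrite (bracketD (phi := phi)); last exact: pderiv_HomK.
  by rewrite rs rs' scalerDl.
- exists (X l * s - r *+ (i == l)) => u.
  by rewrite bracketM rs bracket_var_pderiv scalerBl scalerA scalerMnl.
Qed.

Lemma pderiv_finite f : exists A, forall i, i \notin A -> ∂ i f = 0.
Proof.
elim/(partials_ind p): f => [c|f g [A fA] [B gB]|l f [A fA]].
- by exists fset0 => i _; rewrite pderiv_alg.
- exists (A `|` B)%fset => i; rewrite in_fsetU negb_or => /andP[iA iB].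
  by rewrite pderivD fA ?gB ?addr0.
- exists (l |` A)%fset => i; rewrite in_fset1U negb_or => /andP[il iA].
  by rewrite pderivX (negbTE il) fA ?mulr0 ?addr0.
Qed.

Definition psupp f : {fset I} := sval (cid (pderiv_finite f)).

(* The possibly infinite sum of the operators E_i d/dX_i.                     *)
Definition pderiv_sum E (f : R^o) : R^o := \sum_(i <- psupp f) E i (∂ i f).

(** Extra indices contribute E_i(0) = 0, so several polynomials can be handled over one finite index
    set. *)
Lemma pderiv_sumE E A f : (forall i, HomK phi (E i)) -> (psupp f `<=` A)%fset ->
  pderiv_sum E f = \sum_(i <- A) E i (∂ i f).
Proof.
move=> EK fA; rewrite /pderiv_sum; apply: big_fset_incl => // i _ fi.
by rewrite (svalP (cid (pderiv_finite f))) ?(HomK_eq0 (EK i)).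
Qed.

Lemma pderiv_sum_HomK E : (forall i, HomK phi (E i)) -> HomK phi (pderiv_sum E).
Proof.
move=> EK; split=> [f g|c f].
  pose A := (psupp f `|` psupp g `|` psupp (f + g : R))%fset.
  have fA : (psupp f `<=` A)%fset by rewrite /A -fsetUA fsubsetUl.
  have gA : (psupp g `<=` A)%fset by rewrite /A fsetUAC fsubsetUr.
  have fgA : (psupp (f + g : R) `<=` A)%fset by rewrite fsubsetUr.
  rewrite (pderiv_sumE EK fA) (pderiv_sumE EK gA) (pderiv_sumE EK fgA).
  rewrite -big_split; apply: eq_bigr => i _.
  by rewrite pderivD; case: (EK i) => ->.
pose A := (psupp f `|` psupp (phi c *: f))%fset.
have fA : (psupp f `<=` A)%fset by rewrite fsubsetUl.
have cfA : (psupp (phi c *: f) `<=` A)%fset by rewrite fsubsetUr.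
rewrite (pderiv_sumE EK fA) (pderiv_sumE EK cfA).
rewrite scaler_sumr; apply: eq_bigr => i _.
by case: (pderiv_HomK i) (EK i) => _ -> [_ ->].
Qed.

(* As [X_i, d/dX_i] = -1 and X_i commutes with the other partial derivatives, *)
(* [X_i, sum_l E_l d/dX_l] = sum_l [X_i, E_l] d/dX_l - E_i.                   *)
Lemma bracket_pderiv_sum E i j f : (forall i, HomK phi (E i)) ->
  (forall l u, l != j -> bracket (X i) (E l) u = 0) ->
  bracket (X i) (pderiv_sum E) f = bracket (X i) (E j) (∂ j f) - E i f.
Proof.
move=> EK Ej.
(* Including [i] and [j] allows their terms to be split off. *)
pose A := ([fset i; j] `|` (psupp f `|` psupp (X i *: f)))%fset.
have iA : i \in A by rewrite !inE eqxx.
have jA : j \in A by rewrite !inE eqxx orbT.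
have fA : (psupp f `<=` A)%fset by rewrite /A fsetUCA fsubsetUl.
have XfA : (psupp (X i *: f) `<=` A)%fset by rewrite /A fsetUA fsubsetUr.
rewrite {1}/bracket (pderiv_sumE EK fA) (pderiv_sumE EK XfA).
have -> : bracket (X i) (E j) (∂ j f) =
    \sum_(l <- A) bracket (X i) (E l) (∂ l f).
  rewrite (big_fsetD1 j)//= big1_seq ?addr0// => l /andP[_].
  by rewrite !inE => /andP[/Ej->].
have -> : E i f = \sum_(l <- A) E l (f *+ (l == i)).
  rewrite (big_fsetD1 i)//= eqxx big1_seq ?addr0// => l /andP[_].
  by rewrite !inE => /andP[/negbTE-> _]; rewrite mulr0n (HomK_eq0 (EK l)).
rewrite scaler_sumr -!sumrB; apply: eq_bigr => l _.
rewrite /bracket [∂ l (_ *: f)]pderivX.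
by case: (EK l) => -> _; rewrite opprD addrA addrAC.
Qed.

End Operators.

(** * The recursive construction of D_alpha *)

Section Construction.
Variables (k : comNzRingType) (I : choiceType) (R : comAlgType k).
Variable p : partials I R.

Local Notation X := (var p).
Local Notation "∂" := (pderiv p).
Local Notation phi := (GRing.in_alg R).

(** Commutation with the variables outside the block strengthens the induction: it keeps operators
    on disjoint blocks from interacting. *)
Definition order_on_block (a : ord) (j : chain a -> I) (D : R^o -> R^o) :=
  has_ordinal_order phi D a /\
  forall i, (forall s, j s <> i) -> forall u, bracket (X i) D u = 0.

Section Step.
Variables (a : ord) (j : chain a -> I) (E : I -> R^o -> R^o).
Hypotheses (a1 : inhabited a) (j_inj : injective j).
(** The operator attached to the variable x_y plays the role of D_y, acting on the block of chains
    that continue below [y]. *)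
Hypothesis E_Last : forall y : a,
  order_on_block (fun s : chain (seg y) => j (More s)) (E (j (Last y))).
Hypothesis E_out : forall i, (forall y : a, j (Last y) <> i) -> E i = fun=> 0.

Let EK i : HomK phi (E i).
Proof.
have [[y <-]|iy] := pselect (exists y, j (Last y) = i).
  by have [[_ /ordF_HomK]] := E_Last y.
by rewrite E_out; [exact: HomK0 | move=> y jy; apply: iy; exists y].
Qed.

Let E_bracket i l (u : R^o) :
  (forall (y : a) (s : chain (seg y)), j (Last y) = l -> j (More s) <> i :> I) ->
  bracket (X i) (E l) u = 0.
Proof.
move=> il; have [[y yl]|ly] := pselect (exists y, j (Last y) = l).
  by rewrite -yl; have [_] := E_Last y; apply => s; apply: il.
rewrite E_out; first by rewrite /bracket scaler0 subrr.
by move=> y jy; apply: ly; exists y.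
Qed.

(** By injectivity of [j], x_y lies in no block of a D_z, so it commutes with every E_l. *)
Lemma bracket_Last (y : a) :
  bracket (X (j (Last y))) (pderiv_sum p E) = fun u => - E (j (Last y)) u.
Proof.
apply/funext => u; rewrite (bracket_pderiv_sum (j := j (Last y)))//.
  by rewrite E_bracket ?sub0r// => z s _ /j_inj.
by move=> l v _; apply: E_bracket => z s _ /j_inj.
Qed.

(** Only D_y has this variable in its block, and E vanishes at the variable itself. *)
Lemma bracket_More (y : a) (s : chain (seg y)) :
  bracket (X (j (More s))) (pderiv_sum p E) =
  bracket (X (j (More s))) (E (j (Last y))) \o ∂ (j (Last y)).
Proof.
apply/funext => u; rewrite (bracket_pderiv_sum (j := j (Last y)))//.
  by rewrite [E (j (More s))]E_out ?subr0// => z /j_inj.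
move=> l v /eqP ly; apply: E_bracket => z t zl /j_inj.
move=> zy; apply: ly; rewrite -zl; congr (j (Last _)).
by case: zy.
Qed.

Lemma bracket_other i u : (forall s, j s <> i) ->
  bracket (X i) (pderiv_sum p E) u = 0.
Proof.
move=> ji; rewrite (bracket_pderiv_sum (j := i))//.
  by rewrite E_bracket ?E_out ?subrr// => y s _.
by move=> l v _; apply: E_bracket => y s _.
Qed.

Lemma ordF_pderiv_sum : ordF phi a (pderiv_sum p E).
Proof.
have DK := pderiv_sum_HomK p EK; have [y0] := a1.
(* Induction on the polynomial in the bracket: sums and products take the larger of two levels below
   [a], which leaves the variables. *)
apply: ordF_pos => //; elim/(partials_ind p) => [c|f g|i f].
- exists (seg y0); first exact: seg_lt.
  rewrite (_ : bracket _ _ = fun=> 0); first exact: ordF0.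
  by apply/funext => u; rewrite (bracket_phi (phi := phi)).
- move=> [b ba bF] [c ca cF].
  rewrite (_ : bracket _ _ =
      fun u => bracket f (pderiv_sum p E) u + bracket g (pderiv_sum p E) u).
    have [bc|cb] := ord_lt_linear ba ca.
      by exists c => //; apply: ordFD => //; apply: ordF_le bF.
    by exists b => //; apply: ordFD => //; apply: ordF_le cF.
  by apply/funext => u; rewrite (bracketD (phi := phi)).
suff [c ca cF] : exists2 c, ord_lt c a &
    ordF phi c (bracket (X i) (pderiv_sum p E)).
  move=> [b ba bF].
  rewrite (_ : bracket _ _ = fun u => X i *: bracket f (pderiv_sum p E) u +
      bracket (X i) (pderiv_sum p E) (f *: u)).
    have [bc|cb] := ord_lt_linear ba ca.
      by exists c => //; apply: ordFD; [apply/ordFZ/(ordF_le bc) | exact: ordFZr].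
    by exists b => //; apply: ordFD; [exact: ordFZ | apply/ordFZr/(ordF_le cb)].
  by apply/funext => u; rewrite bracketM.
have [[[y|y s] <-]|ij] := pselect (exists s, j s = i).
- exists (seg y); first exact: seg_lt.
  by rewrite bracket_Last; apply: ordFN; have [[]] := E_Last y.
- exists (seg y); first exact: seg_lt.
  rewrite bracket_More; have [[_ EF _] _] := E_Last y.
  (* If [seg y] is nonempty, the bracket of D_y lies strictly below level [seg y], and the
     derivative raises it at most to that level; otherwise D_y is central and the bracket
     vanishes. *)
  have [y1|y1] := pselect (inhabited (seg y)).
    move/(ordF_posE _ _ y1): EF => [_ /(_ (X (j (More s))))[c cy cF]].
    by apply: ordF_comp cF cy; [exact: pderiv_HomK | exact: bracket_pderiv].
  move/(ordF_zeroE _ _ y1): EF => [_ EF].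
  rewrite (_ : _ \o _ = fun=> 0); first exact: ordF0.
  by apply/funext => u /=; rewrite EF.
- exists (seg y0); first exact: seg_lt.
  rewrite (_ : bracket _ _ = fun=> 0); first exact: ordF0.
  by apply/funext => u; apply: bracket_other => s si; apply: ij; exists s.
Qed.

Lemma order_on_block_pderiv_sum : order_on_block j (pderiv_sum p E).
Proof.
have EN0 y : bracket (X (j (Last y))) (pderiv_sum p E) <> fun=> 0.
  rewrite bracket_Last => E0; have [[EN _ _] _] := E_Last y; apply: EN.
  by apply/funext => u; rewrite -[LHS]opprK (congr1 (fun h => h u) E0) oppr0.
split; last by move=> i ji u; apply: bracket_other.
split.
- have [y] := a1; move=> D0; apply: (EN0 y).
  by apply/funext => u; rewrite D0 /bracket scaler0 subrr.
- exact: ordF_pderiv_sum.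
move=> b DF; have [b1|b0] := pselect (inhabited b); last first.
  have [y] := a1; move/(ordF_zeroE _ _ b0): DF => [_ D0].
  by case: (EN0 y); apply/funext => u; rewrite D0.
(* The bracket with x_y is -D_y, of order exactly [seg y], and lies at a level below [b]; so each
   [seg y] is below [b]. *)
apply: ord_le_seg => y; move/(ordF_posE _ _ b1): DF => [_ /(_ (X (j (Last y))))].
move=> [c cb]; rewrite bracket_Last => /ordFN cF.
have [[_ _ Emin] _] := E_Last y; apply: ord_le_lt_trans cb; apply: Emin.
rewrite (_ : E _ = fun u => - - E (j (Last y)) u)//.
by apply/funext => u; rewrite opprK.
Qed.

End Step.

Lemma order_on_block_id (a : ord) (j : chain a -> I) :
  ~ inhabited a -> order_on_block j id.
Proof.
move=> a0; have br0 r (u : R^o) : bracket r id u = 0 by rewrite /bracket subrr.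
split=> [|i _ u]; last exact: br0.
split=> [id0||b _]; last exact: ord_le_empty.
  by have /eqP := congr1 (fun h => h 1) id0; rewrite oner_eq0.
exact: ordF_central.
Qed.

(** The labelling [j] varies in the induction, so that the hypothesis applies to each sub-block
    [j (More s)]. *)
Lemma order_on_block_ex (a : ord) (j : chain a -> I) :
  injective j -> exists D, order_on_block j D.
Proof.
elim/(well_founded_ind ord_lt_wf): a j => a IH j j_inj.
have [a1|a0] := pselect (inhabited a); last by exists id; apply: order_on_block_id.
have /choice[D DP] (y : a) :
    exists D, order_on_block (fun s : chain (seg y) => j (More s)) D.
  by apply: IH; [exact: seg_lt | exact: inj_comp j_inj (@More_inj a y)].
(* Injectivity of [j] makes it consistent to put [D y] at [j (Last y)] and zero elsewhere. *)
have E_ex i : exists e : R^o -> R^o,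
    (forall y, j (Last y) = i -> e = D y) /\
    ((forall y : a, j (Last y) <> i) -> e = fun=> 0).
  have [[y yi]|iy] := pselect (exists y, j (Last y) = i).
    exists (D y); split=> [z|/(_ y)//].
    by rewrite -yi => /j_inj[->].
  exists (fun=> 0); split=> // y yi; by case: iy; exists y.
have [E EP] := choice E_ex.
exists (pderiv_sum p E); apply: order_on_block_pderiv_sum => // [y|i].
  by have [/(_ y erefl)-> _] := EP (j (Last y)); apply: DP.
by have [] := EP i.
Qed.

End Construction.

(** * Cardinality of the set of variables *)

Lemma card_lt_inj (A B C : Type) (f : A -> B) :
  injective f -> card_lt B C -> card_lt A C.
Proof.
move=> f_inj [BC CB].
have AB : ([set: A] #<= [set: B])%card.
  have /card_eqPle[_ Af] : (range f #= [set: A])%card.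
    by apply: inj_card_eq => x y _ _; apply: f_inj.
  exact: card_le_trans Af (card_leT _).
split; first exact: card_le_trans BC.
by move=> CA; apply: CB; apply: card_le_trans CA AB.
Qed.

Lemma card_lt_finite (T : finType) (kappa : Type) :
  infinite_set [set: kappa] -> card_lt T kappa.
Proof.
move=> k_inf.
have nT : ~ ([set: kappa] #<= [set: T])%card.
  by move=> kT; apply: k_inf; apply: card_le_finite kT _; apply: finite_finset.
split=> //; move/infiniteP: k_inf; apply: card_le_trans.
by apply/countableP.
Qed.

Lemma card_lt_option (A kappa : Type) : regular_cardinal kappa ->
  card_lt A kappa -> card_lt (option A) kappa.
Proof.
move=> [k_inf k_reg] Ak.
(* Adding one point is a sum over a two-element index set, to which regularity applies. *)
pose F (b : bool) : Type := if b then A else unit.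
have bF : card_lt {b & F b} kappa.
  apply: k_reg => [|[]//]; first exact: card_lt_finite.
  exact: card_lt_finite.
pose f (x : option A) : {b & F b} :=
  if x is Some y then existT F true y else existT F false tt.
pose g (x : {b & F b}) : option A :=
  match x with existT true y => Some y | existT false _ => None end.
by apply: card_lt_inj bF; apply: (@can_inj _ _ f g); case.
Qed.

(** A chain is an element [y] with possibly a chain below [y]; regularity bounds this sum, induction
    its summands. *)
Lemma card_lt_chain (kappa : Type) (a : ord) : regular_cardinal kappa ->
  card_lt a kappa -> card_lt (chain a) kappa.
Proof.
move=> k_reg; elim/(well_founded_ind ord_lt_wf): a => a IH ak.
pose F (y : a) : Type := option (chain (seg y)).
have aF : card_lt {y & F y} kappa.
  case: (k_reg) => _; apply=> // y; apply: card_lt_option => //.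
  apply: IH; first exact: seg_lt.
  apply: card_lt_inj (initial_embedding_inj (@seg_embedding a y)) ak.
exact: card_lt_inj (@chain_uncons_inj a) aF.
Qed.

Theorem theorem4p4 (k : fieldType) (kappa : Type)
    (kappa_regular : regular_cardinal kappa)
    (alpha : ord) (alpha_lt : card_lt alpha kappa) :
  exists Lambda : choiceType, card_lt Lambda kappa /\
    let R : comAlgType k := polyalg k Lambda in
    exists D : R^o -> R^o,
      quite_diff_op (GRing.in_alg R) D /\
      has_ordinal_order (GRing.in_alg R) D alpha.
Proof.
(* [{classic _}] equips the chains with a choice structure. Labelled by [id], the block consists of
   all variables. *)
exists {classic (chain alpha)}; split; first exact: card_lt_chain.
have [|D [Dalpha _]] :=
  @order_on_block_ex k {classic (chain alpha)} _ (polyalg_partials _ _) alpha id.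
  by move=> x y.
by exists D; split=> //; exists alpha; have [] := Dalpha.
Qed.
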